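(* Let $M=B_f\times{}_hF$ be a doubly warped product manifold with metric $g$, let $P\in\mathfrak{X}(B)$, and suppose that $(M,\tilde\nabla)$ is Einstein with Einstein constant $\mu$. Suppose that $B$ is a compact Riemannian manifold, $F$ is a complete Riemannian manifold, $n_1,n_2\ge 2$, and $H_F^f$ is a constant multiple of $g_F$. If $\mu\le 0$, $Ph\ge 0$, $\pi(P)\le 0$ and $\mathrm{div}P\le 0$, then $M$ is a warped product manifold.
   Context: $(B,g_B)$ and $(F,g_F)$ are Riemannian manifolds of dimensions $n_1$ and $n_2$, and $h:B\to(0,\infty)$, $f:F\to(0,\infty)$ are smooth. With $\rho:B\times F\to B$, $\sigma:B\times F\to F$ the projections, the doubly warped product $M=B_f\times{}_hF$ is $B\times F$ with the metric $g=(f\circ\sigma)^2\rho^*g_B+(h\circ\rho)^2\sigma^*g_F$. $M$ is (reduces to) a warped product manifold if one of the warping functions $f$, $h$ is constant. The functions $f,h$ and vector fields on $B$ and $F$ are identified with their lifts to $M$; $P\in\mathfrak{X}(B)$ means the lift of a vector field of $B$. $\nabla,{}^B\nabla,{}^F\nabla$ are the Levi-Civita connections of $M,B,F$. $H_F^f(V,W)=VWf-({}^F\nabla_VW)f$ is the Hessian of $f$ on $F$. For $P\in\mathfrak{X}(B)$, $\mathrm{div}P=\sum_i g({}^B\nabla_{e_i}P,e_i)$ over a $g$-orthonormal frame $(e_i)$ tangent to $B$ (${}^B\nabla$ applied leafwise). Put $\pi(A)=g(A,P)$. The semi-symmetric metric connection on $M$ associated with $P$ is $\tilde\nabla_AC=\nabla_AC+\pi(C)A-g(A,C)P$.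 Conventions: $\tilde R(A,C)D=\tilde\nabla_A\tilde\nabla_CD-\tilde\nabla_C\tilde\nabla_AD-\tilde\nabla_{[A,C]}D$ and $\tilde S(C,D)=\mathrm{trace}(A\mapsto\tilde R(A,C)D)$. $(M,\tilde\nabla)$ is Einstein with Einstein constant $\mu$ if $\tilde S=\mu g$, $\mu\in\mathbb{R}$ constant. *)

(* Defs.v *)
From HB Require Import structures.
From mathcomp Require Import all_boot all_order all_algebra.
From mathcomp Require Import all_classical all_reals all_analysis.

Set Implicit Arguments.
Unset Strict Implicit.
Unset Printing Implicit Defensive.

Import Order.TTheory GRing.Theory Num.Theory.
Import numFieldNormedType.Exports.

Local Open Scope classical_set_scope.
Local Open Scope ring_scope.

(* [class_C k U u] and [smooth U u] are meant for open sets U of a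
   finite-dimensional space, where they are C^k and C^oo on U. *)
Fixpoint class_C (R : realType) (V W : normedModType R) (k : nat)
    (U : set V) (u : V -> W) : Prop :=
  match k with
  | 0%N => forall x, U x -> {for x, continuous u}
  | k'.+1 => (forall x, U x -> differentiable u x) /\
             (forall v : V, class_C k' U (fun x => 'D_v u x))
  end.

Definition smooth (R : realType) (V W : normedModType R)
    (U : set V) (u : V -> W) : Prop :=
  forall k, class_C k U u.

(* A topological space with a family of R^n-valued charts; the axioms of a
   smooth manifold are in [is_manifold]. Chart maps are total functions, only
   meaningful on [chart_dom i] and [chart_cod i] respectively. *)
Record charts (R : realType) (n : nat) := Charts {
  space :> topologicalType;
  chart_index : Type;
  chart_dom : chart_index -> set space;
  chart : chart_index -> space -> 'rV[R]_n;
  chart_inv : chart_index -> 'rV[R]_n -> space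
}.

Section Manifold.
Context {R : realType} {n : nat} (M : charts R n).

Definition chart_cod (i : chart_index M) : set 'rV[R]_n :=
  chart i @` chart_dom i.

Definition transition (i j : chart_index M) : 'rV[R]_n -> 'rV[R]_n :=
  chart j \o chart_inv i.

(* Manifolds are connected, Hausdorff and second countable. *)
Record is_manifold : Prop := IsManifold {
  manifold_hausdorff : hausdorff_space M;
  manifold_second_countable : @second_countable M;
  manifold_connected : connected [set: M];
  chart_cover : forall p : M, exists i : chart_index M, chart_dom i p;
  chart_dom_open : forall i : chart_index M, open (chart_dom i);
  chart_cod_open : forall i : chart_index M, open (chart_cod i);
  chartK : forall (i : chart_index M) (p : M),
    chart_dom i p -> chart_inv i (chart i p) = p;
  chart_continuous : forall (i : chart_index M) (p : M),
    chart_dom i p -> {for p, continuous (chart i)};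
  chart_inv_continuous : forall (i : chart_index M) (x : 'rV[R]_n),
    chart_cod i x -> {for x, continuous (chart_inv i)};
  transition_smooth : forall i j : chart_index M,
    smooth (chart i @` (chart_dom i `&` chart_dom j)) (transition i j)
}.

Definition in_chart (u : M -> R) (i : chart_index M) : 'rV[R]_n -> R :=
  u \o chart_inv i.

Definition smooth_function (u : M -> R) : Prop :=
  forall i, smooth (chart_cod i) (in_chart u i).

(* Tensor fields are given by their components in every chart, subject to the
   transformation law under change of charts. Tangent vectors at x are row
   vectors of components in the coordinate frame. *)
Definition vector_field_data := chart_index M -> 'rV[R]_n -> 'rV[R]_n.

Definition is_vector_field (X : vector_field_data) : Prop :=
  (forall i, smooth (chart_cod i) (X i)) /\
  (forall i j (p : M), chart_dom i p -> chart_dom j p ->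
     X j (chart j p) = 'D_(X i (chart i p)) (transition i j) (chart i p)).

Definition metric_data := chart_index M -> 'rV[R]_n -> 'M[R]_n.

End Manifold.

Definition pairing (R : realType) (n : nat) (G : 'M[R]_n) (v w : 'rV[R]_n) : R :=
  (v *m G *m w^T) 0 0.

Record is_riemannian_metric (R : realType) (n : nat) (M : charts R n)
    (g : metric_data M) : Prop := IsRiemannianMetric {
  metric_smooth : forall i, smooth (chart_cod i) (g i);
  metric_sym : forall i x, chart_cod i x -> (g i x)^T = g i x;
  metric_pos : forall i x, chart_cod i x ->
    forall v, v != 0 -> 0 < pairing (g i x) v v;
  metric_change : forall i j (p : M), chart_dom i p -> chart_dom j p ->
    forall v w, pairing (g i (chart i p)) v w =
      pairing (g j (chart j p)) ('D_v (transition i j) (chart i p))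
                                ('D_w (transition i j) (chart i p))
}.

Section LocalGeometry.
Context {R : realType} {n : nat}.

Definition local_field := 'rV[R]_n -> 'rV[R]_n.
Definition local_connection := local_field -> local_field -> local_field.

Implicit Types (U : set 'rV[R]_n) (G : 'rV[R]_n -> 'M[R]_n)
  (A C D P : local_field) (nabla : local_connection).

Definition lie_derive A (u : 'rV[R]_n -> R) : 'rV[R]_n -> R :=
  fun x => 'D_(A x) u x.

Definition bracket A C : local_field :=
  fun x => 'D_(A x) C x - 'D_(C x) A x.

Definition inner G A C : 'rV[R]_n -> R := fun x => pairing (G x) (A x) (C x).

(* Affine connections on the open set U, acting on smooth fields on U. *)
Record is_affine_connection U nabla : Prop := IsAffineConnection {
  connection_smooth : forall A C, smooth U A -> smooth U C ->
    smooth U (nabla A C);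
  connectionDl : forall A A' C, smooth U A -> smooth U A' -> smooth U C ->
    forall x, U x ->
      nabla (fun y => A y + A' y) C x = nabla A C x + nabla A' C x;
  connectionZl : forall (u : 'rV[R]_n -> R) A C,
    smooth U u -> smooth U A -> smooth U C ->
    forall x, U x -> nabla (fun y => u y *: A y) C x = u x *: nabla A C x;
  connectionDr : forall A C C', smooth U A -> smooth U C -> smooth U C' ->
    forall x, U x ->
      nabla A (fun y => C y + C' y) x = nabla A C x + nabla A C' x;
  connection_leibniz : forall (u : 'rV[R]_n -> R) A C,
    smooth U u -> smooth U A -> smooth U C ->
    forall x, U x ->
      nabla A (fun y => u y *: C y) x =
      u x *: nabla A C x + lie_derive A u x *: C x
}.

Record is_local_levi_civita U G nabla : Prop := IsLocalLeviCivita {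
  levi_civita_connection : is_affine_connection U nabla;
  levi_civita_torsion_free : forall A C, smooth U A -> smooth U C ->
    forall x, U x -> nabla A C x - nabla C A x = bracket A C x;
  levi_civita_metric : forall A C D,
    smooth U A -> smooth U C -> smooth U D ->
    forall x, U x -> lie_derive A (inner G C D) x =
      inner G (nabla A C) D x + inner G C (nabla A D) x
}.

Definition semi_symmetric nabla G P : local_connection :=
  fun A C x =>
    nabla A C x + inner G C P x *: A x - inner G A C x *: P x.

Definition curvature nabla A C D : local_field :=
  fun x => nabla A (nabla C D) x - nabla C (nabla A D) x
           - nabla (bracket A C) D x.

(* The curvature at x only depends on the value at x of its arguments, hence
   the trace over tangent vectors a at x, extended as constant fields. *)
Definition ricci nabla C D : 'rV[R]_n -> R :=
  fun x => \tr (lin1_mx (fun a => curvature nabla (cst a) C D x)).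

Definition hessian nabla (u : 'rV[R]_n -> R) (V W : local_field) :
    'rV[R]_n -> R :=
  fun x => lie_derive V (lie_derive W u) x - lie_derive (nabla V W) u x.

End LocalGeometry.

Section Riemannian.
Context {R : realType} {n : nat} (M : charts R n).

(* A connection is a local operator, so it is given by its restrictions to the
   chart domains. *)
Definition connection_data := chart_index M -> @local_connection R n.

Implicit Types (g : metric_data M) (nabla : connection_data).

Definition is_levi_civita g nabla : Prop :=
  forall i, is_local_levi_civita (chart_cod i) (g i) (nabla i).

Definition is_einstein g nabla (mu : R) : Prop :=
  forall i C D, smooth (chart_cod i) C -> smooth (chart_cod i) D ->
  forall x, chart_cod i x -> ricci (nabla i) C D x = mu * inner (g i) C D x.

Definition hessian_multiple g nabla (u : M -> R) (c : R) : Prop :=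
  forall i V W, smooth (chart_cod i) V -> smooth (chart_cod i) W ->
  forall x, chart_cod i x ->
    hessian (nabla i) (in_chart u i) V W x = c * inner (g i) V W x.

Definition smooth_curve (gamma : R -> M) : Prop :=
  continuous gamma /\
  forall i : chart_index M,
    smooth (gamma @^-1` chart_dom i) (chart i \o gamma).

(* For constant fields, nabla (cst v) (cst v) x is the Christoffel term
   Gamma(v, v) at x, so this is the usual second-order geodesic equation. *)
Definition is_geodesic nabla (gamma : R -> M) : Prop :=
  smooth_curve gamma /\
  forall (i : chart_index M) (t : R), chart_dom i (gamma t) ->
    let c : R -> 'rV[R]_n := chart i \o gamma in
    let v := derive1 c t in
    derive1 (derive1 c) t + nabla i (cst v) (cst v) (c t) = 0.

(* Geodesic completeness. *)
Definition is_complete nabla : Prop :=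
  forall (i : chart_index M) (p : M) (v : 'rV[R]_n), chart_dom i p ->
  exists gamma : R -> M, [/\ is_geodesic nabla gamma, gamma 0 = p
    & derive1 (chart i \o gamma) 0 = v].

End Riemannian.

Definition prod_charts (R : realType) (n1 n2 : nat)
    (B : charts R n1) (F : charts R n2) : charts R (n1 + n2) :=
  {| space := (B * F)%type;
     chart_index := (chart_index B * chart_index F)%type;
     chart_dom := fun ij => chart_dom ij.1 `*` chart_dom ij.2;
     chart := fun ij p => row_mx (chart ij.1 p.1) (chart ij.2 p.2);
     chart_inv := fun ij z =>
       (chart_inv ij.1 (lsubmx z), chart_inv ij.2 (rsubmx z)) |}.

Section DoublyWarped.
Context {R : realType} {n1 n2 : nat} (B : charts R n1) (F : charts R n2).

Definition doubly_warped_metric (gB : metric_data B) (gF : metric_data F)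
    (f : F -> R) (h : B -> R) : metric_data (prod_charts B F) :=
  fun ij z =>
    let b := lsubmx z in let y := rsubmx z in
    block_mx (in_chart f ij.2 y ^+ 2 *: gB ij.1 b) 0
             0 (in_chart h ij.1 b ^+ 2 *: gF ij.2 y).

Definition lift_vector (v : 'rV[R]_n1) : 'rV[R]_(n1 + n2) := row_mx v 0.

Definition lift_field (P : vector_field_data B) :
    vector_field_data (prod_charts B F) :=
  fun ij z => lift_vector (P ij.1 (lsubmx z)).

Definition semi_symmetric_connection (g : metric_data (prod_charts B F))
    (nabla : connection_data (prod_charts B F)) (P : vector_field_data B) :
    connection_data (prod_charts B F) :=
  fun ij => semi_symmetric (nabla ij) (g ij) (lift_field P ij).

(* The rows of E are the vectors of a g-orthonormal frame at z of the tangent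
   space of B. *)
Definition orthonormal_frame (g : metric_data (prod_charts B F))
    (ij : chart_index (prod_charts B F)) (z : 'rV[R]_(n1 + n2))
    (E : 'M[R]_n1) : Prop :=
  forall k l, pairing (g ij z) (lift_vector (row k E)) (lift_vector (row l E))
              = (k == l)%:R.

Definition divergence (g : metric_data (prod_charts B F))
    (nablaB : connection_data B) (P : vector_field_data B)
    (ij : chart_index (prod_charts B F)) (z : 'rV[R]_(n1 + n2))
    (E : 'M[R]_n1) : R :=
  \sum_(k < n1)
    pairing (g ij z)
      (lift_vector (nablaB ij.1 (cst (row k E)) (P ij.1) (lsubmx z)))
      (lift_vector (row k E)).

Definition is_warped_product (f : F -> R) (h : B -> R) : Prop :=
  (exists c, forall q, f q = c) \/ (exists c, forall p, h p = c).

End DoublyWarped.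

(* Main.v *)
Require Import Defs.
From HB Require Import structures.
From mathcomp Require Import all_boot all_order all_algebra.
From mathcomp Require Import all_classical all_reals all_analysis.
From mathcomp Require Import ring zify.

Set Implicit Arguments.
Unset Strict Implicit.
Unset Printing Implicit Defensive.

Import Order.TTheory GRing.Theory Num.Theory.
Import numFieldNormedType.Exports.

Local Open Scope classical_set_scope.
Local Open Scope ring_scope.

(** The hypothesis pi(P) <= 0 says that the lift of P is a vector of nonpositive
    Riemannian length, so P vanishes and the semi-symmetric connection is the
    Levi-Civita connection of the doubly warped metric. The manifold M is then
    Einstein in the ordinary sense, and the theorem follows from one component
    of the Ricci tensor: for X tangent to B and V tangent to F,

      Ric(X, V) = (n1 + n2 - 2) X(ln h) V(ln f)       ([ricci_mixed]).

    Since X and V are orthogonal, the Einstein equation makes this vanish, and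
    n1 + n2 > 2. Hence if dh is nonzero at a single point of B, then df is zero
    at every point of F, and f is constant because F is connected
    ([manifold_derive0_cst]); otherwise h is constant by the same lemma.

    The formula is computed in a product chart, with coordinate fields, from
    R(A, X)V = nabla_A nabla_X V - nabla_X nabla_A V. The Koszul formula gives

      nabla_X V = V(ln f) X + X(ln h) V               ([christoffel_mixed]).

    For A = Y tangent to B, the component of R(Y, X)V along B is
    V(ln f) (X(ln h) Y - Y(ln h) X), whose trace in Y is
    (n1 - 1) X(ln h) V(ln f). For A = W tangent to F, the component of R(W, X)V
    along F is V(ln f) X(ln h) W - (nabla_X N_W)^F, where N_W is the component
    along B of nabla_W V. The maps W |-> N_W and N |-> (nabla_X N)^F are given by
    the second fundamental forms of the two foliations, with values proportional
    to grad h and grad f; their composite has trace X(ln h) V(ln f), so that this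
    second part contributes (n2 - 1) X(ln h) V(ln f).

    Only these two diagonal blocks enter the trace; the second derivatives of h
    and f occur in the other blocks of R(A, X)V. *)

(** * Differentiable and smooth maps *)

Lemma near_eq_differentiable (R : realType) (V W : normedModType R)
    (u w : V -> W) (x : V) :
  (\forall y \near x, u y = w y) -> differentiable u x -> differentiable w x.
Proof.
move=> uw du; have ux := nbhs_singleton uw.
apply/diffP => /=.
apply: (@getPex _ (fun (df : {linear V -> W}) => continuous df /\
  forall y, w y = w (lim (nbhs x)) + df (y - lim (nbhs x))
                  +o_(y \near x) (y - lim (nbhs x)))).
case: (du) => -[cdu /eqaddoP du'].
exists ('d u x); split=> //.
suff : w = cst (w (lim (nbhs x))) + 'd u x \o center (lim (nbhs x))
   +o_ (nbhs x) (center (lim (nbhs x))).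
  by move=> {1}->.
apply/eqaddoP => e e0; near=> z.
have -> : (w - (cst (w (lim (nbhs x))) + 'd u x \o center (lim (nbhs x)))) z =
  (u - (cst (u (lim (nbhs x))) + 'd u x \o center (lim (nbhs x)))) z.
  by rewrite !fctE /= lim_id// -ux (near uw z).
near: z; exact: du'.
Unshelve. all: by end_near. Qed.

Section SmoothMaps.
Context {R : realType}.
Implicit Types V W : normedModType R.

(** Smoothness is a property of the germs of u along U: in the inductive step the
    derivatives of u and w agree on U because U is open. *)
Lemma class_C_eq V W k (U : set V) (u w : V -> W) :
  open U -> {in U, u =1 w} -> class_C k U u -> class_C k U w.
Proof.
move=> oU; elim: k u w => [|k IH] u w uw.
  move=> uC x Ux; rewrite /prop_for /continuous_at -(uw x) ?inE//.
  apply: cvg_trans (uC x Ux); apply: near_eq_cvg.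
  near=> y; rewrite uw// inE; near: y; exact: open_nbhs_nbhs.
move=> [du Cu]; split=> [x Ux|v].
  apply: near_eq_differentiable (du x Ux).
  near=> y; rewrite uw// inE; near: y; exact: open_nbhs_nbhs.
apply: IH (Cu v) => x /set_mem Ux; apply: near_eq_derive.
near=> y; rewrite uw// inE; near: y; exact: open_nbhs_nbhs.
Unshelve. all: by end_near. Qed.

Lemma smooth_eq V W (U : set V) (u w : V -> W) :
  open U -> {in U, u =1 w} -> smooth U u -> smooth U w.
Proof. by move=> oU uw su k; apply: class_C_eq (su k). Qed.

Lemma smooth_differentiable V W (U : set V) (u : V -> W) x :
  smooth U u -> U x -> differentiable u x.
Proof. by move=> /(_ 1%N)[du _] /du. Qed.

Lemma smooth_cst V W (U : set V) (w : W) : smooth U (cst w : V -> W).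
Proof.
move=> k; elim: k w => [|k IH] w; first by move=> x _; apply: cst_continuous.
split=> [x _|v].
  apply: differentiable_cst.
by rewrite (_ : (fun x => _) = cst 0)//; apply/funext => x; rewrite derive_cst.
Qed.

Lemma derive_linear V W W' (L : {linear W -> W'}) (u : V -> W) x v :
  continuous L -> differentiable u x -> 'D_v (L \o u) x = L ('D_v u x).
Proof.
move=> cL du; have dL : differentiable L (u x) by exact: linear_differentiable.
rewrite deriveE; last exact: differentiable_comp.
by rewrite diff_comp//= diff_lin// deriveE.
Qed.

Lemma smooth_linear V W W' (L : {linear W -> W'}) (U : set V) (u : V -> W) :
  open U -> continuous L -> smooth U u -> smooth U (L \o u).
Proof.
move=> oU cL su k; elim: k u su => [|k IH] u su.
  by move=> x Ux; apply: continuous_comp; [exact: (su 0%N)|exact: cL].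
split=> [x Ux|v].
  by apply: differentiable_comp; [exact: smooth_differentiable su Ux|
    exact: linear_differentiable].
apply: (@class_C_eq _ _ _ _ (L \o (fun x => 'D_v u x))) => //.
  move=> x /set_mem Ux /=; rewrite derive_linear//.
  exact: smooth_differentiable su Ux.
by apply: IH => l; have [_] := su l.+1; apply.
Qed.

Lemma matrix_linear_continuous W m n (L : {linear 'M[R]_(m, n) -> W}) :
  continuous L.
Proof.
have -> : (L : 'M[R]_(m, n) -> W) =
    fun A => \sum_i \sum_j A i j *: L (delta_mx i j).
  apply/funext => A; rewrite [in LHS](matrix_sum_delta A) linear_sum.
  by under eq_bigr do [rewrite linear_sum; under eq_bigr do rewrite linearZ].
apply: continuous_big; first exact: add_continuous.
move=> i _; apply: continuous_big; first exact: add_continuous.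
move=> j _ A; apply: differentiable_continuous; apply: differentiableZl.
exact: differentiable_coord.
Qed.

(** A directional derivative depends only on the restriction of the map to a line.
    This moves derivatives between a product and its factors. *)
Lemma derive_along V V' W (u : V -> W) (u' : V' -> W) x x' v v' :
  (forall t, u (t *: v + x) = u' (t *: v' + x')) -> 'D_v u x = 'D_v' u' x'.
Proof.
move=> e; rewrite /derive.
rewrite (_ : (fun t : R => t^-1 *: ((u \o shift x) (t *: v) - u x)) =
  fun t : R => t^-1 *: ((u' \o shift x') (t *: v') - u' x'))//.
apply/funext => t /=.
by rewrite e; have := e 0; rewrite !scale0r !add0r => ->.
Qed.

Lemma derive_along_near_cst V W (u : V -> W) x v :
  (\forall t \near (0 : R), u (t *: v + x) = u x) -> 'D_v u x = 0.
Proof.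
move=> e; rewrite (@derive_along _ _ _ _ (fun t : R => u (t *: v + x)) x 0 v 1).
  rewrite (@near_eq_derive _ _ _ _ (cst (u x))) ?derive_cst//.
by move=> t; rewrite addr0 /GRing.scale/= mulr1.
Qed.

End SmoothMaps.

(** * Connections in a chart *)

Section LocalConnection.
Context {R : realType} {n : nat}.
Implicit Types (U : set 'rV[R]_n) (nabla : @local_connection R n)
  (G : 'rV[R]_n -> 'M[R]_n).

(** The Christoffel symbols, as a bilinear map on tangent vectors: the covariant
    derivative of one constant-coefficient field along another. *)
Definition christoffel nabla (a c : 'rV[R]_n) : 'rV[R]_n -> 'rV[R]_n :=
  nabla (cst a) (cst c).

Lemma near_line U (x v : 'rV[R]_n) : open U -> U x ->
  \forall t \near (0 : R), U (t *: v + x).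
Proof.
move=> oU Ux.
have : (fun t : R => t *: v + x) @ 0 --> x.
  rewrite -[X in _ --> X]add0r -(scale0r v).
  by apply: cvgD; [apply: cvgZr_tmp; exact: cvg_id | exact: cvg_cst].
by apply; exact: open_nbhs_nbhs.
Qed.

(** A name for the entry functions, to which their linearity can be attached. *)
Definition mx_coord m p i j (A : 'M[R]_(m, p)) : R := A i j.

Lemma mx_coord_is_linear m p i j : linear (@mx_coord m p i j : _ -> R^o).
Proof. by move=> a A C; rewrite /mx_coord !mxE. Qed.

HB.instance Definition _ m p i j := GRing.isLinear.Build R 'M[R]_(m, p) R^o _
  (@mx_coord m p i j) (mx_coord_is_linear i j).

Lemma derive_coord (V : normedModType R) m p (C : V -> 'M[R]_(m, p)) x v i j :
  differentiable C x -> 'D_v (fun y => C y i j) x = ('D_v C x) i j.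
Proof.
move=> dC; apply: (@derive_linear _ _ _ R^o (@mx_coord m p i j)) => //.
exact: matrix_linear_continuous.
Qed.

Lemma christoffelDr U nabla a c c' x : is_affine_connection U nabla -> U x ->
  christoffel nabla a (c + c') x = christoffel nabla a c x + christoffel nabla a c' x.
Proof. by move=> aff Ux; apply: (connectionDr aff) => //; exact: smooth_cst. Qed.

Lemma christoffelZr U nabla a s c x : is_affine_connection U nabla -> U x ->
  christoffel nabla a (s *: c) x = s *: christoffel nabla a c x.
Proof.
move=> aff Ux; have := connection_leibniz aff (smooth_cst U s)
  (smooth_cst U a) (smooth_cst U c) Ux.
by rewrite /lie_derive derive_cst scale0r addr0.
Qed.

(** The classical expression of a connection in coordinates. It follows from
    writing C as the finite sum of its coordinates times the coordinate fields
    and applying additivity and the Leibniz rule; the right-hand side shows that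
    nabla (cst a) C at x depends only on the germ of C. *)
Lemma affine_connectionE U nabla a C x : open U ->
  is_affine_connection U nabla -> smooth U C -> U x ->
  nabla (cst a) C x = christoffel nabla a (C x) x + 'D_a C x.
Proof.
move=> oU aff sC Ux; pose e (k : 'I_n) : 'rV[R]_n := delta_mx 0 k.
have partial (s : seq 'I_n) :
    nabla (cst a) (fun y => \sum_(k <- s) C y 0 k *: e k) x =
    \sum_(k <- s) (C x 0 k *: christoffel nabla a (e k) x + 'D_a C x 0 k *: e k).
  have coordE y k : C y 0 k *: e k = C y *m delta_mx k k.
    rewrite {2}(row_sum_delta (C y)) mulmx_suml (bigD1 k)//= -scalemxAl.
    rewrite mul_delta_mx big1 ?addr0// => i ik.
    by rewrite -scalemxAl mul_delta_mx_0 ?scaler0.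
  have smooth_mul (A : 'M[R]_n) : smooth U (fun y => C y *m A).
    apply: (@smooth_linear _ _ _ _ (mulmxr A)) => //.
    exact: matrix_linear_continuous.
  have smooth_coord k : smooth U (fun y => C y 0 k).
    apply: (@smooth_linear _ _ _ R^o (@mx_coord 1 n 0 k)) => //.
    exact: matrix_linear_continuous.
  elim: s => [|k s IHs].
    rewrite big_nil; under eq_fun do rewrite big_nil.
    have := @christoffelZr _ _ a 0 0 _ aff Ux.
    by rewrite !scale0r.
  rewrite big_cons -IHs; under eq_fun do rewrite big_cons.
  rewrite (connectionDr aff)//; last 3 first.
  - exact: smooth_cst.
  - by under eq_fun do rewrite coordE; exact: smooth_mul.
  - under eq_fun do (under eq_bigr do rewrite coordE; rewrite -mulmx_sumr).
    exact: smooth_mul.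
  rewrite (connection_leibniz aff)//; last 2 first.
  - exact: smooth_cst.
  - exact: smooth_cst.
  rewrite /lie_derive derive_coord//.
  exact: smooth_differentiable sC Ux.
(* The derivative terms reassemble into 'D_a C x, and the others into the same
   expansion of the constant field with value C x. *)
have {1}-> : C = fun y => \sum_k C y 0 k *: e k.
  by apply/funext => y; rewrite {1}(row_sum_delta (C y)).
rewrite partial big_split/= -row_sum_delta; congr (_ + _).
rewrite {2}(row_sum_delta (C x)).
elim: (index_enum _) => [|k s IHs].
  rewrite !big_nil; have := @christoffelZr _ _ a 0 0 _ aff Ux.
  by rewrite !scale0r.
by rewrite !big_cons (christoffelDr _ _ _ aff)// (christoffelZr _ _ _ aff)// IHs.
Qed.

Lemma christoffel_smooth U nabla a c : is_affine_connection U nabla ->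
  smooth U (christoffel nabla a c).
Proof. by move=> aff; apply: (connection_smooth aff); exact: smooth_cst. Qed.

Lemma bracket_cst (a c : 'rV[R]_n) : bracket (cst a) (cst c) = cst 0.
Proof. by apply/funext => x; rewrite /bracket !derive_cst subrr. Qed.

Lemma curvature_cst U nabla a c d x : open U -> is_affine_connection U nabla ->
  U x ->
  curvature nabla (cst a) (cst c) (cst d) x =
    christoffel nabla a (christoffel nabla c d x) x
    + 'D_a (christoffel nabla c d) x
    - (christoffel nabla c (christoffel nabla a d x) x
       + 'D_c (christoffel nabla a d) x).
Proof.
move=> oU aff Ux; rewrite /curvature bracket_cst.
have -> : nabla (cst 0) (cst d) x = 0.
  have := connectionZl aff (smooth_cst U 0)
    (smooth_cst U 0) (smooth_cst U d) Ux.
  by under eq_fun do rewrite scale0r; rewrite scale0r.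
rewrite subr0 -!/(christoffel nabla _ _).
by rewrite !(affine_connectionE _ oU aff)//; exact: christoffel_smooth aff.
Qed.

(** Connections are given as operators on total maps, hence may disagree outside
    U even if they agree on U; locality of nabla makes this harmless. *)
Lemma ricci_eq_on U nabla nabla' c d x : open U ->
  is_affine_connection U nabla ->
  (forall A C y, U y -> nabla' A C y = nabla A C y) -> U x ->
  ricci nabla' (cst c) (cst d) x = ricci nabla (cst c) (cst d) x.
Proof.
move=> oU aff eqn Ux; rewrite /ricci; congr (\tr (lin1_mx _)).
apply/funext => a; rewrite /curvature !eqn//.
have local a' c' : nabla (cst a') (nabla' (cst c') (cst d)) x =
                   nabla (cst a') (nabla (cst c') (cst d)) x.
  have sC := @christoffel_smooth _ _ c' d aff.
  rewrite -/(christoffel nabla c' d) !(affine_connectionE _ oU aff)//.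
    rewrite eqn//; congr (_ + _); apply: near_eq_derive.
    near=> y; apply: eqn; near: y; exact: open_nbhs_nbhs.
  by apply: smooth_eq sC => // y /set_mem Uy; rewrite eqn.
by rewrite !local.
Unshelve. all: by end_near. Qed.

Lemma pairingDl (H : 'M[R]_n) v v' w :
  pairing H (v + v') w = pairing H v w + pairing H v' w.
Proof. by rewrite /pairing !mulmxDl mxE. Qed.

Lemma pairingC (H : 'M[R]_n) v w : H^T = H -> pairing H v w = pairing H w v.
Proof.
move=> sH; rewrite /pairing.
suff -> : w *m H *m v^T = (v *m H *m w^T)^T by rewrite [RHS]mxE.
by rewrite !trmx_mul trmxK sH mulmxA.
Qed.

Lemma christoffelC U G nabla a c x : is_local_levi_civita U G nabla -> U x ->
  christoffel nabla a c x = christoffel nabla c a x.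
Proof.
move=> lc Ux; apply/eqP; rewrite -subr_eq0; apply/eqP.
rewrite (levi_civita_torsion_free lc) ?bracket_cst//; exact: smooth_cst.
Qed.

(** Coordinate fields commute, so the bracket terms of the Koszul formula are
    absent. *)
Lemma koszul U G nabla a c d x : is_local_levi_civita U G nabla ->
  (forall y, U y -> (G y)^T = G y) -> U x ->
  2 * pairing (G x) (christoffel nabla a c x) d =
    'D_a (fun y => pairing (G y) c d) x + 'D_c (fun y => pairing (G y) a d) x
    - 'D_d (fun y => pairing (G y) a c) x.
Proof.
move=> lc sG Ux.
have compat u v w : 'D_u (fun y => pairing (G y) v w) x =
    pairing (G x) (christoffel nabla u v x) w +
    pairing (G x) (christoffel nabla u w x) v.
  have := levi_civita_metric lc (smooth_cst U u) (smooth_cst U v)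
    (smooth_cst U w) Ux.
  rewrite /lie_derive /inner => ->; congr (_ + _); apply: pairingC; exact: sG.
rewrite !compat (christoffelC d c lc)// (christoffelC d a lc)//.
rewrite (christoffelC c a lc)//; ring.
Qed.

Lemma pairing_inj (H : 'M[R]_n) v w :
  (forall u, u != 0 -> 0 < pairing H u u) ->
  (forall u, pairing H v u = pairing H w u) -> v = w.
Proof.
move=> pos eqvw; apply/eqP; rewrite -subr_eq0; apply: contraT => /pos.
suff -> : pairing H (v - w) (v - w) = 0 by rewrite ltxx.
by rewrite pairingDl eqvw -pairingDl subrr /pairing !mul0mx mxE.
Qed.

End LocalConnection.

(** * Algebra of the doubly warped metric *)

Lemma pairing0l (R : realType) n (H : 'M[R]_n) w : pairing H 0 w = 0.
Proof. by rewrite /pairing !mul0mx mxE. Qed.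

Lemma pairing0r (R : realType) n (H : 'M[R]_n) w : pairing H w 0 = 0.
Proof. by rewrite /pairing trmx0 mulmx0 mxE. Qed.

Lemma pairingZl (R : realType) n (H : 'M[R]_n) a v w :
  pairing H (a *: v) w = a * pairing H v w.
Proof. by rewrite /pairing -!scalemxAl mxE. Qed.

Lemma pairing_diag (R : realType) n1 n2 (H1 : 'M[R]_n1) (H2 : 'M[R]_n2)
    (s1 s2 : R) a1 c1 a2 c2 :
  pairing (block_mx (s1 *: H1) 0 0 (s2 *: H2)) (row_mx a1 a2) (row_mx c1 c2) =
  s1 * pairing H1 a1 c1 + s2 * pairing H2 a2 c2.
Proof.
rewrite /pairing mul_row_block !mulmx0 addr0 add0r tr_row_mx mul_row_col mxE.
by rewrite -!scalemxAr -!scalemxAl !mxE.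
Qed.

Lemma posdef_unitmx (R : realType) n (H : 'M[R]_n) :
  (forall v, v != 0 -> 0 < pairing H v v) -> H \in unitmx.
Proof.
move=> pos; rewrite -row_free_unit -kermx_eq0; apply/rowV0P => v /sub_kermxP vH.
apply/eqP; apply: contraT => /pos; by rewrite /pairing vH mul0mx mxE ltxx.
Qed.

Lemma derive_sqrM (R : realType) (V : normedModType R) (u : V -> R) (c : R) x v :
  differentiable u x ->
  'D_v (fun y => u y ^+ 2 * c) x = 2 * u x * 'D_v u x * c.
Proof.
move=> du; have dv : derivable u x v by exact: diff_derivable.
have -> : (fun y => u y ^+ 2 * c) = c \o* (u ^+ 2).
  by apply/funext => y; rewrite /= fctE.
rewrite deriveMr; last exact: derivableX.
by rewrite deriveX// /GRing.scale/= expr1 [RHS]mulrC.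
Qed.

Lemma derive_row_sum (R : realType) n (u : 'rV[R]_n -> R) x v :
  differentiable u x -> 'D_v u x = \sum_i v 0 i * 'D_(delta_mx 0 i) u x.
Proof.
move=> du; rewrite deriveE// {1}(row_sum_delta v) linear_sum.
by apply: eq_bigr => i _; rewrite linearZ deriveE.
Qed.

Lemma open_row_mx (R : realType) n1 n2 (U1 : set 'rV[R]_n1)
    (U2 : set 'rV[R]_n2) : open U1 -> open U2 ->
  open [set z : 'rV[R]_(n1 + n2) | U1 (lsubmx z) /\ U2 (rsubmx z)].
Proof.
move=> oU1 oU2; apply: openI; apply: open_comp => // z _.
  exact: continuous_lsubmx.
exact: continuous_rsubmx.
Qed.

Definition fiber_vector (R : realType) n1 n2 (V : 'rV[R]_n2) : 'rV[R]_(n1 + n2) :=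
  row_mx 0 V.

(** The derivative of ln u in the direction v. *)
Definition dlog (R : realType) (V : normedModType R) (u : V -> R) v x : R :=
  'D_v u x / u x.

Lemma dlog_row_sum (R : realType) n (u : 'rV[R]_n -> R) x v :
  differentiable u x -> dlog u v x = \sum_i dlog u (delta_mx 0 i) x * v 0 i.
Proof.
move=> du; rewrite /dlog derive_row_sum// mulr_suml.
by apply: eq_bigr => i _; ring.
Qed.

(** * The mixed Ricci curvature *)

(** A product chart of a doubly warped product: U1 and U2 are the chart codomains
    in B and F, G1 and G2 the component matrices of the two metrics, and phi, psi
    the warping functions f and h. *)
Section DoublyWarpedLocal.
Context {R : realType} {n1 n2 : nat}.
Variables (U1 : set 'rV[R]_n1) (U2 : set 'rV[R]_n2).
Variables (G1 : 'rV[R]_n1 -> 'M[R]_n1) (G2 : 'rV[R]_n2 -> 'M[R]_n2).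
Variables (phi : 'rV[R]_n2 -> R) (psi : 'rV[R]_n1 -> R).

Let U : set 'rV[R]_(n1 + n2) := [set z | U1 (lsubmx z) /\ U2 (rsubmx z)].

Let G (z : 'rV[R]_(n1 + n2)) : 'M[R]_(n1 + n2) :=
  block_mx (phi (rsubmx z) ^+ 2 *: G1 (lsubmx z)) 0
           0 (psi (lsubmx z) ^+ 2 *: G2 (rsubmx z)).

Local Notation hor := (@lift_vector R n1 n2).
Local Notation ver := (@fiber_vector R n1 n2).

Hypotheses (oU1 : open U1) (oU2 : open U2).
Hypothesis sG1 : forall x, U1 x -> (G1 x)^T = G1 x.
Hypothesis pG1 : forall x, U1 x -> forall v, v != 0 -> 0 < pairing (G1 x) v v.
Hypothesis sG2 : forall x, U2 x -> (G2 x)^T = G2 x.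
Hypothesis pG2 : forall x, U2 x -> forall v, v != 0 -> 0 < pairing (G2 x) v v.
Hypothesis dG2 : forall x, U2 x -> differentiable G2 x.
Hypothesis phi_pos : forall x, U2 x -> 0 < phi x.
Hypothesis dphi : forall x, U2 x -> differentiable phi x.
Hypothesis psi_pos : forall x, U1 x -> 0 < psi x.
Hypothesis dpsi : forall x, U1 x -> differentiable psi x.

Lemma openU : open U.
Proof. exact: open_row_mx. Qed.

Lemma symG z : U z -> (G z)^T = G z.
Proof.
by move=> [z1 z2]; rewrite /G tr_block_mx !linearZ /= sG1// sG2// !trmx0.
Qed.

Lemma line_base (z : 'rV[R]_(n1 + n2)) t X :
  (lsubmx (t *: hor X + z) = t *: X + lsubmx z) *
  (rsubmx (t *: hor X + z) = rsubmx z).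
Proof.
by rewrite !linearD !linearZ /= /lift_vector row_mxKl row_mxKr scaler0 add0r.
Qed.

Lemma line_fiber (z : 'rV[R]_(n1 + n2)) t V :
  (rsubmx (t *: ver V + z) = t *: V + rsubmx z) *
  (lsubmx (t *: ver V + z) = lsubmx z).
Proof.
by rewrite !linearD !linearZ /= /fiber_vector row_mxKl row_mxKr scaler0 add0r.
Qed.

Lemma pairing_base z X Y :
  pairing (G z) (hor X) (hor Y) = phi (rsubmx z) ^+ 2 * pairing (G1 (lsubmx z)) X Y.
Proof. by rewrite pairing_diag pairing0l mulr0 addr0. Qed.

Lemma pairing_fiber z V W :
  pairing (G z) (ver V) (ver W) = psi (lsubmx z) ^+ 2 * pairing (G2 (rsubmx z)) V W.
Proof. by rewrite pairing_diag pairing0l mulr0 add0r. Qed.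

Lemma pairing_base_fiber z X W : pairing (G z) (hor X) (ver W) = 0.
Proof. by rewrite pairing_diag pairing0l pairing0r !mulr0 addr0. Qed.

Lemma pairing_fiber_base z X W : pairing (G z) (ver W) (hor X) = 0.
Proof. by rewrite pairing_diag pairing0l pairing0r !mulr0 addr0. Qed.

Lemma pairing_baser z v X : pairing (G z) v (hor X) =
  phi (rsubmx z) ^+ 2 * pairing (G1 (lsubmx z)) (lsubmx v) X.
Proof. by rewrite -{1}(hsubmxK v) pairing_diag pairing0r mulr0 addr0. Qed.

Lemma pairing_fiberr z v V : pairing (G z) v (ver V) =
  psi (lsubmx z) ^+ 2 * pairing (G2 (rsubmx z)) (rsubmx v) V.
Proof. by rewrite -{1}(hsubmxK v) pairing_diag pairing0r mulr0 add0r. Qed.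

Lemma derive_fiber_pairing_base z V X Y : U z ->
  'D_(ver V) (fun z => pairing (G z) (hor X) (hor Y)) z =
  2 * phi (rsubmx z) * 'D_V phi (rsubmx z) * pairing (G1 (lsubmx z)) X Y.
Proof.
move=> [z1 z2].
rewrite (@derive_along _ _ _ _ _
  (fun y => phi y ^+ 2 * pairing (G1 (lsubmx z)) X Y) _ (rsubmx z) _ V).
  by rewrite derive_sqrM//; exact: dphi.
by move=> t; rewrite pairing_base !line_fiber.
Qed.

Lemma derive_base_pairing_fiber z X V W : U z ->
  'D_(hor X) (fun z => pairing (G z) (ver V) (ver W)) z =
  2 * psi (lsubmx z) * 'D_X psi (lsubmx z) * pairing (G2 (rsubmx z)) V W.
Proof.
move=> [z1 z2].
rewrite (@derive_along _ _ _ _ _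
  (fun x => psi x ^+ 2 * pairing (G2 (rsubmx z)) V W) _ (lsubmx z) _ X).
  by rewrite derive_sqrM//; exact: dpsi.
by move=> t; rewrite pairing_fiber !line_base.
Qed.

Lemma derive_pairing_base_fiber z v X V :
  'D_v (fun z => pairing (G z) (hor X) (ver V)) z = 0.
Proof. by under eq_fun do rewrite pairing_base_fiber; rewrite derive_cst. Qed.

Lemma derive_pairing_fiber_base z v X V :
  'D_v (fun z => pairing (G z) (ver V) (hor X)) z = 0.
Proof. by under eq_fun do rewrite pairing_fiber_base; rewrite derive_cst. Qed.

Lemma derive_fiber_pairing_fiber z Z V W : U z ->
  'D_(ver Z) (fun z => pairing (G z) (ver V) (ver W)) z =
  psi (lsubmx z) ^+ 2 * 'D_Z (fun y => pairing (G2 y) V W) (rsubmx z).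
Proof.
move=> [z1 z2].
rewrite (@derive_along _ _ _ _ _
  (fun y => psi (lsubmx z) ^+ 2 * pairing (G2 y) V W) _ (rsubmx z) _ Z).
  rewrite deriveMl//; apply: diff_derivable.
  apply: (@differentiable_comp _ _ _ _ (fun y => V *m G2 y *m W^T)
    (fun A : 'M[R]_1 => A 0 0)); last exact: differentiable_coord.
  apply: (@differentiable_comp _ _ _ _ G2 (mulmxr W^T \o mulmx V)).
    exact: dG2.
  apply: linear_differentiable; exact: matrix_linear_continuous.
by move=> t; rewrite pairing_fiber !line_fiber.
Qed.

Variable nabla : @local_connection R (n1 + n2).
Hypothesis lc : is_local_levi_civita U G nabla.
Let aff := levi_civita_connection lc.
Local Notation Gam := (christoffel nabla).

Lemma christoffel_mixed z X V : U z ->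
  Gam (hor X) (ver V) z =
  dlog phi V (rsubmx z) *: hor X + dlog psi X (lsubmx z) *: ver V.
Proof.
move=> Uz; have [z1 z2] := Uz.
have phi0 := lt0r_neq0 (phi_pos z2); have psi0 := lt0r_neq0 (psi_pos z1).
rewrite -[LHS]hsubmxK !scale_row_mx !scaler0 add_row_mx addr0 add0r.
congr row_mx.
- apply: (pairing_inj (pG1 z1)) => Y.
  have := koszul (hor X) (ver V) (hor Y) lc symG Uz.
  rewrite pairing_baser derive_pairing_base_fiber derive_pairing_fiber_base.
  rewrite derive_fiber_pairing_base// !add0r subr0.
  rewrite pairingZl /dlog => e.
  apply: (mulfI (expf_neq0 2 phi0)); apply: (mulfI (_ : 2 != 0 :> R)) => //.
  by rewrite e; field.
- apply: (pairing_inj (pG2 z2)) => W.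
  have := koszul (hor X) (ver V) (ver W) lc symG Uz.
  rewrite pairing_fiberr !derive_pairing_base_fiber.
  rewrite derive_base_pairing_fiber// addr0 subr0.
  rewrite pairingZl /dlog => e.
  apply: (mulfI (expf_neq0 2 psi0)); apply: (mulfI (_ : 2 != 0 :> R)) => //.
  by rewrite e; field.
Qed.

(** The second fundamental form of the leaves tangent to F, a multiple of the
    gradient of psi. *)
Lemma christoffel_fiber_horizontal z W V X : U z ->
  phi (rsubmx z) ^+ 2 * pairing (G1 (lsubmx z)) (lsubmx (Gam (ver W) (ver V) z)) X =
  - (psi (lsubmx z) * 'D_X psi (lsubmx z) * pairing (G2 (rsubmx z)) W V).
Proof.
move=> Uz; rewrite -pairing_baser.
have := koszul (ver W) (ver V) (hor X) lc symG Uz.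
rewrite !derive_pairing_fiber_base derive_base_pairing_fiber// !add0r => e.
by apply: (mulfI (_ : 2 != 0 :> R)) => //; rewrite e; ring.
Qed.

(** The leaves tangent to F carry homothetic copies of the metric of F, which all
    have the same Levi-Civita connection. *)
Lemma christoffel_fiber_vertical_invariant z z' W V :
  U z -> U z' -> rsubmx z' = rsubmx z ->
  rsubmx (Gam (ver W) (ver V) z') = rsubmx (Gam (ver W) (ver V) z).
Proof.
move=> Uz Uz' zz'; have [z1 z2] := Uz; apply: (pairing_inj (pG2 z2)) => u.
have char y : U y -> rsubmx y = rsubmx z ->
    2 * pairing (G2 (rsubmx z)) (rsubmx (Gam (ver W) (ver V) y)) u =
    'D_W (fun x => pairing (G2 x) V u) (rsubmx z)
    + 'D_V (fun x => pairing (G2 x) W u) (rsubmx z)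
    - 'D_u (fun x => pairing (G2 x) W V) (rsubmx z).
  move=> Uy yz; have [y1 y2] := Uy.
  have := koszul (ver W) (ver V) (ver u) lc symG Uy.
  rewrite pairing_fiberr !derive_fiber_pairing_fiber// yz => e.
  apply: (mulfI (expf_neq0 2 (lt0r_neq0 (psi_pos y1)))).
  by rewrite mulrCA e; ring.
by apply: (mulfI (_ : 2 != 0 :> R)) => //; rewrite !char.
Qed.

(** The second fundamental form of the leaves tangent to B, a multiple of the
    gradient of phi. *)
Lemma christoffel_base_vertical z X N u : U z ->
  psi (lsubmx z) ^+ 2 * pairing (G2 (rsubmx z)) (rsubmx (Gam (hor X) (hor N) z)) u =
  - (phi (rsubmx z) * 'D_u phi (rsubmx z) * pairing (G1 (lsubmx z)) N X).
Proof.
move=> Uz; have [z1 z2] := Uz; rewrite -pairing_fiberr (pairingC N X (sG1 z1)).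
have := koszul (hor X) (hor N) (ver u) lc symG Uz.
rewrite !derive_pairing_base_fiber derive_fiber_pairing_base// !add0r => e.
by apply: (mulfI (_ : 2 != 0 :> R)) => //; rewrite e; ring.
Qed.

(** Composing the two second fundamental forms: as a map of W, the vector
    (nabla_X N_W)^F is X(ln psi) G2(W, V) times the G2-gradient of ln phi, so
    this operator has rank at most one. *)
Lemma christoffel_base_fiber_vertical z X V W u : U z ->
  pairing (G2 (rsubmx z))
    (rsubmx (Gam (hor X) (hor (lsubmx (Gam (ver W) (ver V) z))) z)) u =
  dlog psi X (lsubmx z) * dlog phi u (rsubmx z) * pairing (G2 (rsubmx z)) W V.
Proof.
move=> Uz; have [z1 z2] := Uz.
have phi0 := lt0r_neq0 (phi_pos z2); have psi0 := lt0r_neq0 (psi_pos z1).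
apply: (mulfI (expf_neq0 2 psi0)); rewrite christoffel_base_vertical//.
apply: (mulfI (expf_neq0 2 phi0)).
rewrite mulrN mulrCA christoffel_fiber_horizontal// /dlog.
by field; rewrite psi0 phi0.
Qed.

Lemma derive_base_eq0 (V' : normedModType R) (u : 'rV[R]_(n1 + n2) -> V') z X : U z ->
  (forall z', U z' -> rsubmx z' = rsubmx z -> u z' = u z) -> 'D_(hor X) u z = 0.
Proof.
move=> Uz eu; apply: derive_along_near_cst.
near=> t; apply: eu; last by rewrite !line_base.
by near: t; exact: near_line openU Uz.
Unshelve. all: by end_near. Qed.

Lemma derive_fiber_eq0 (V' : normedModType R) (u : 'rV[R]_(n1 + n2) -> V') z V : U z ->
  (forall z', U z' -> lsubmx z' = lsubmx z -> u z' = u z) -> 'D_(ver V) u z = 0.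
Proof.
move=> Uz eu; apply: derive_along_near_cst.
near=> t; apply: eu; last by rewrite !line_fiber.
by near: t; exact: near_line openU Uz.
Unshelve. all: by end_near. Qed.

Lemma lsubmx_derive_christoffel v a c z : U z ->
  lsubmx ('D_v (Gam a c) z) = 'D_v (fun y => lsubmx (Gam a c y)) z.
Proof.
move=> Uz; rewrite -(@derive_linear _ _ _ _ lsubmx)//.
  exact: matrix_linear_continuous.
exact: smooth_differentiable (christoffel_smooth a c aff) Uz.
Qed.

Lemma rsubmx_derive_christoffel v a c z : U z ->
  rsubmx ('D_v (Gam a c) z) = 'D_v (fun y => rsubmx (Gam a c y)) z.
Proof.
move=> Uz; rewrite -(@derive_linear _ _ _ _ rsubmx)//.
  exact: matrix_linear_continuous.
exact: smooth_differentiable (christoffel_smooth a c aff) Uz.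
Qed.

Lemma lsubmx_christoffel_mixed z X V : U z ->
  lsubmx (Gam (hor X) (ver V) z) = dlog phi V (rsubmx z) *: X.
Proof.
move=> Uz; rewrite christoffel_mixed// linearD !linearZ/=.
by rewrite row_mxKl row_mxKl scaler0 addr0.
Qed.

Lemma rsubmx_christoffel_mixed z X V : U z ->
  rsubmx (Gam (hor X) (ver V) z) = dlog psi X (lsubmx z) *: V.
Proof.
move=> Uz; rewrite christoffel_mixed// linearD !linearZ/=.
by rewrite row_mxKr row_mxKr scaler0 add0r.
Qed.

(** The terms with nabla_Y X = nabla_X Y cancel, and Y(V(ln phi)) = 0 since phi
    does not vary along B. The second derivatives of ln psi multiply V, which is
    tangent to F. *)
Lemma curvature_mixed_horizontal z X V Y : U z ->
  lsubmx (curvature nabla (cst (hor Y)) (cst (hor X)) (cst (ver V)) z) =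
  dlog phi V (rsubmx z) *:
    (dlog psi X (lsubmx z) *: Y - dlog psi Y (lsubmx z) *: X).
Proof.
move=> Uz; rewrite (curvature_cst _ _ _ openU aff Uz).
have half X' Y' : lsubmx (Gam (hor Y') (Gam (hor X') (ver V) z) z
      + 'D_(hor Y') (Gam (hor X') (ver V)) z) =
    dlog phi V (rsubmx z) *: lsubmx (Gam (hor Y') (hor X') z)
    + dlog psi X' (lsubmx z) *: (dlog phi V (rsubmx z) *: Y').
  rewrite linearD/= lsubmx_derive_christoffel// (derive_base_eq0 _ Uz) ?addr0.
    rewrite christoffel_mixed// (christoffelDr _ _ _ aff)//.
    rewrite !(christoffelZr _ _ _ aff)// linearD !linearZ/= lsubmx_christoffel_mixed//.
    by rewrite !scalerA [dlog psi _ _ * _]mulrC.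
  by move=> z' Uz' e; rewrite !lsubmx_christoffel_mixed// e.
rewrite linearB/= !half (christoffelC (hor X) (hor Y) lc Uz).
rewrite opprD addrACA subrr add0r scalerBr !scalerA.
by rewrite ![dlog psi _ _ * _]mulrC.
Qed.

(** The vertical part of nabla_W V contributes X(ln psi) times itself to both
    nabla_W nabla_X V and nabla_X nabla_W V, and has no derivative along B by
    [christoffel_fiber_vertical_invariant]. *)
Lemma curvature_mixed_vertical z X V W : U z ->
  rsubmx (curvature nabla (cst (ver W)) (cst (hor X)) (cst (ver V)) z) =
  (dlog phi V (rsubmx z) * dlog psi X (lsubmx z)) *: W -
  rsubmx (Gam (hor X) (hor (lsubmx (Gam (ver W) (ver V) z))) z).
Proof.
move=> Uz; rewrite (curvature_cst _ _ _ openU aff Uz).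
rewrite linearB !linearD/= !rsubmx_derive_christoffel//.
rewrite (derive_base_eq0 _ Uz); last first.
  by move=> z' Uz' e; exact: christoffel_fiber_vertical_invariant.
rewrite (derive_fiber_eq0 _ Uz); last first.
  by move=> z' Uz' e; rewrite !rsubmx_christoffel_mixed// e.
rewrite !addr0 christoffel_mixed// (christoffelDr _ _ _ aff)//.
rewrite !(christoffelZr _ _ _ aff)// linearD !linearZ/=.
rewrite (christoffelC (ver W) (hor X) lc Uz) rsubmx_christoffel_mixed//.
set E := Gam (ver W) (ver V) z.
have -> : rsubmx (Gam (hor X) E z) =
    rsubmx (Gam (hor X) (hor (lsubmx E)) z) + dlog psi X (lsubmx z) *: rsubmx E.
  have {1}-> : E = hor (lsubmx E) + ver (rsubmx E).
    by rewrite add_row_mx addr0 add0r hsubmxK.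
  by rewrite (christoffelDr _ _ _ aff)// linearD/= rsubmx_christoffel_mixed.
by rewrite scalerA opprD addrACA subr0 -addrA subrK.
Qed.


(** The operator of [christoffel_base_fiber_vertical] is a covector times a vector,
    and its trace is the value of the one on the other. *)
Lemma trace_christoffel_base_fiber z X V : U z ->
  \sum_(j < n2) rsubmx (Gam (hor X)
      (hor (lsubmx (Gam (ver (delta_mx 0 j)) (ver V) z))) z) 0 j =
  dlog psi X (lsubmx z) * dlog phi V (rsubmx z).
Proof.
move=> Uz; have [z1 z2] := Uz; set H := G2 (rsubmx z).
have uH : H \in unitmx by apply: posdef_unitmx; exact: pG2.
(* b *m invmx H is the gradient of ln phi for the metric H. *)
pose b : 'rV[R]_n2 := \row_k dlog phi (delta_mx 0 k) (rsubmx z).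
have KE w : rsubmx (Gam (hor X) (hor (lsubmx (Gam (ver w) (ver V) z))) z) =
    (dlog psi X (lsubmx z) * pairing H w V) *: (b *m invmx H).
  set K := rsubmx _; rewrite -[K](mulmxK uH) scalemxAl; congr (_ *m _).
  apply/rowP => k; rewrite !mxE.
  have := christoffel_base_fiber_vertical X V w (delta_mx 0 k) Uz.
  rewrite -/K -/H {1}/pairing trmx_delta -colE !mxE => ->.
  by rewrite mulrAC.
under eq_bigr do rewrite KE mxE -mulrA.
rewrite -mulr_sumr; congr (_ * _); rewrite (dlog_row_sum _ (dphi z2)).
have -> : \sum_j pairing H (delta_mx 0 j) V * (b *m invmx H) 0 j =
    ((b *m invmx H) *m (H *m V^T)) 0 0.
  rewrite mxE; apply: eq_bigr => j _; rewrite mulrC; congr (_ * _).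
  by rewrite /pairing -mulmxA -rowE mxE.
rewrite mulmxA mulmxKV// mxE; apply: eq_bigr => j _.
by rewrite !mxE.
Qed.

Lemma ricci_mixed z X V : U z ->
  ricci nabla (cst (hor X)) (cst (ver V)) z =
  ((n1 + n2)%:R - 2) * (dlog psi X (lsubmx z) * dlog phi V (rsubmx z)).
Proof.
move=> Uz; have [z1 z2] := Uz; rewrite /ricci /mxtrace big_split_ord/=.
have -> : \sum_(i < n1) lin1_mx (fun a => curvature nabla (cst a)
      (cst (hor X)) (cst (ver V)) z) (lshift n2 i) (lshift n2 i) =
    dlog phi V (rsubmx z) * (n1%:R * dlog psi X (lsubmx z) - dlog psi X (lsubmx z)).
  transitivity (\sum_(i < n1) dlog phi V (rsubmx z) * (dlog psi X (lsubmx z)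
      - dlog psi (delta_mx 0 i) (lsubmx z) * X 0 i)).
    apply: eq_bigr => i _; rewrite mxE delta_mx_lshift.
    have := congr1 (fun v : 'rV[R]_n1 => v 0 i) (curvature_mixed_horizontal X V (delta_mx 0 i) Uz).
    by rewrite /lift_vector mxE => ->; rewrite !mxE !eqxx mulr1.
  rewrite -mulr_sumr sumrB -(dlog_row_sum _ (dpsi z1)) sumr_const card_ord.
  by rewrite mulr_natl.
have -> : \sum_(j < n2) lin1_mx (fun a => curvature nabla (cst a)
      (cst (hor X)) (cst (ver V)) z) (rshift n1 j) (rshift n1 j) =
    n2%:R * (dlog phi V (rsubmx z) * dlog psi X (lsubmx z)) -
    dlog psi X (lsubmx z) * dlog phi V (rsubmx z).
  rewrite -(trace_christoffel_base_fiber X V Uz) mulr_natl -[X in _ *+ X]card_ord -sumr_const -sumrB.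
  apply: eq_bigr => j _; rewrite mxE delta_mx_rshift.
  have := congr1 (fun v : 'rV[R]_n2 => v 0 j) (curvature_mixed_vertical X V (delta_mx 0 j) Uz).
  by rewrite /fiber_vector mxE => ->; rewrite !mxE !eqxx mulr1.
rewrite natrD; ring.
Qed.

End DoublyWarpedLocal.

(** * Functions with zero derivative on a manifold *)

Lemma ball_derive0_cst (R : realType) (V : normedModType R) (u : V -> R) x e :
  (forall y, ball x e y -> differentiable u y) ->
  (forall y v, ball x e y -> 'D_v u y = 0) ->
  forall y, ball x e y -> u y = u x.
Proof.
move=> du D0 y; rewrite -ball_normE /= => xy.
pose c (t : R) : V := t *: (y - x) + x.
have inball (t : R) : 0 <= t <= 1 -> ball x e (c t).
  move=> /andP[t0 t1]; rewrite -ball_normE /= /c opprD addrCA subrr addr0 normrN.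
  rewrite normrZ ger0_norm// distrC; apply: le_lt_trans xy.
  by rewrite ler_piMl.
have du1 (t : R) : 0 <= t <= 1 -> is_derive t (1 : R) (u \o c) 0.
  move=> /inball ct; apply: DeriveDef.
    apply/derivable1_diffP/differentiable_comp; last exact: du.
    by apply: differentiableD => //; exact: differentiableZl.
  rewrite (@derive_along _ _ _ _ _ u _ (c t) _ (y - x)); first exact: D0.
  by move=> s; rewrite /= /c addrA -scalerDl [_ *: 1]mulr1.
have [||t _] := @MVT_segment R (u \o c) (cst 0) 0 1 ler01.
- move=> t; rewrite in_itv/= => /andP[t0 t1]; apply: du1.
  by rewrite !ltW.
- apply: derivable_within_continuous => t; rewrite in_itv/= => /du1 dt.
  exact: ex_derive.
by rewrite /= /c mul0r scale1r scale0r add0r subrK => /eqP; rewrite subr_eq0 => /eqP.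
Qed.

(** The function is locally constant, so each of its level sets is open and
    closed. *)
Lemma manifold_derive0_cst (R : realType) n (M : charts R n) (u : M -> R) :
  is_manifold M -> smooth_function u ->
  (forall i x v, chart_cod i x -> 'D_v (in_chart u i) x = 0) ->
  exists c, forall p, u p = c.
Proof.
move=> mM su D0.
have loc p : \forall q \near p, u q = u p.
  have [i ip] := chart_cover mM p.
  have codp : chart_cod i (chart i p) by exists p.
  have /nbhs_ballP[e /= e0 xe] : nbhs (chart i p) (chart_cod i).
    by apply: open_nbhs_nbhs; split=> //; exact: (chart_cod_open mM).
  near=> q.
  have iq : chart_dom i q.
    near: q; apply: open_nbhs_nbhs; split=> //; exact: (chart_dom_open mM).
  have xq : ball (chart i p) e (chart i q).
    by near: q; apply: (chart_continuous mM ip); exact: nbhsx_ballx.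
  have uE r : chart_dom i r -> u r = in_chart u i (chart i r).
    by move=> ir; rewrite /in_chart /= (chartK mM).
  rewrite !uE//; apply: ball_derive0_cst xq => [y|y v] /xe iy; last exact: D0.
  exact: smooth_differentiable (su i) iy.
have [[p0 _]|noM] := pselect (exists p : M, True); last first.
  by exists 0 => p; case: noM; exists p.
exists (u p0) => p.
suff e : [set q | u q = u p0] = [set: M] by have : [set: M] p by []; rewrite -e.
apply: (manifold_connected mM); first by exists p0.
- exists [set q | u q = u p0]; last by rewrite setTI.
  rewrite openE => q /= qp; rewrite /interior /=; near=> r.
  by rewrite /= (near (loc q) r).
- exists [set q | u q = u p0]; last by rewrite setTI.
  rewrite -openC openE => q /= qp; rewrite /interior /=; near=> r.
  by rewrite /= (near (loc q) r).
Unshelve. all: by end_near. Qed.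

(** * Doubly warped products *)

Lemma prod_chart_cod (R : realType) n1 n2 (B : charts R n1) (F : charts R n2)
    (ij : chart_index (prod_charts B F)) :
  chart_cod ij = [set z | chart_cod ij.1 (lsubmx z) /\ chart_cod ij.2 (rsubmx z)].
Proof.
apply/seteqP; split=> z /=.
  move=> [[p q] /= [ip jq] <-]; rewrite row_mxKl row_mxKr.
  by split; [exists p|exists q].
move=> [[p ip pz] [q jq qz]]; exists (p, q); first by split.
by rewrite /= pz qz hsubmxK.
Qed.

Lemma chart_cod_row_mx (R : realType) n1 n2 (B : charts R n1) (F : charts R n2)
    (i : chart_index B) (j : chart_index F) x y :
  chart_cod i x -> chart_cod j y ->
  chart_cod ((i, j) : chart_index (prod_charts B F)) (row_mx x y).
Proof. by rewrite prod_chart_cod /= row_mxKl row_mxKr. Qed.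

Lemma prod_chart_cod_open (R : realType) n1 n2 (B : charts R n1)
    (F : charts R n2) (ij : chart_index (prod_charts B F)) :
  is_manifold B -> is_manifold F -> open (chart_cod ij).
Proof.
move=> mB mF; rewrite prod_chart_cod.
apply: open_row_mx; [exact: chart_cod_open mB _|exact: chart_cod_open mF _].
Qed.

Lemma ricci_doubly_warped_mixed (R : realType) n1 n2 (B : charts R n1)
    (F : charts R n2) (gB : metric_data B) (gF : metric_data F)
    (f : F -> R) (h : B -> R) (nabla : connection_data (prod_charts B F))
    i j x y X V :
  is_manifold B -> is_riemannian_metric gB ->
  is_manifold F -> is_riemannian_metric gF ->
  smooth_function f -> (forall q, 0 < f q) ->
  smooth_function h -> (forall p, 0 < h p) ->
  is_levi_civita (doubly_warped_metric gB gF f h) nabla ->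
  chart_cod i x -> chart_cod j y ->
  ricci (nabla (i, j)) (cst (lift_vector X)) (cst (fiber_vector n1 V))
    (row_mx x y) =
  ((n1 + n2)%:R - 2) * (dlog (in_chart h i) X x * dlog (in_chart f j) V y).
Proof.
move=> mB rB mF rF sf fpos sh hpos lc ix jy.
have Uz := chart_cod_row_mx ix jy; have lcz := lc (i, j).
rewrite prod_chart_cod in Uz lcz.
have := ricci_mixed (@chart_cod_open _ _ _ mB i) (@chart_cod_open _ _ _ mF j)
  (fun w Uw => Defs.metric_sym rB Uw) (fun w Uw => metric_pos rB Uw)
  (fun w Uw => Defs.metric_sym rF Uw) (fun w Uw => metric_pos rF Uw)
  (fun w => smooth_differentiable (metric_smooth rF j) (x := w))
  (fun w _ => fpos _) (fun w => smooth_differentiable (sf j) (x := w))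
  (fun w _ => hpos _) (fun w => smooth_differentiable (sh i) (x := w))
  lcz X V Uz.
by rewrite row_mxKl row_mxKr.
Qed.

Theorem theorem5p2 (R : realType) (n1 n2 : nat)
  (B : charts R n1) (F : charts R n2)
  (gB : metric_data B) (gF : metric_data F)
  (f : F -> R) (h : B -> R) (P : vector_field_data B)
  (nablaB : connection_data B) (nablaF : connection_data F)
  (nabla : connection_data (prod_charts B F))
  (mu : R) :
  let M := prod_charts B F in
  let g : metric_data M := doubly_warped_metric gB gF f h in
  is_manifold B -> is_riemannian_metric gB ->
  is_manifold F -> is_riemannian_metric gF ->
  smooth_function f -> (forall q, 0 < f q) ->
  smooth_function h -> (forall p, 0 < h p) ->
  is_levi_civita gB nablaB -> is_levi_civita gF nablaF ->
  is_levi_civita g nabla ->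
  is_vector_field P ->
  is_einstein g (semi_symmetric_connection g nabla P) mu ->
  compact [set: B] -> is_complete nablaF ->
  (2 <= n1)%N -> (2 <= n2)%N ->
  (exists c : R, hessian_multiple gF nablaF f c) ->
  mu <= 0 ->
  (forall i x, chart_cod i x -> 0 <= lie_derive (P i) (in_chart h i) x) ->
  (forall (ij : chart_index M) z, chart_cod ij z ->
     inner (g ij) (lift_field P ij) (lift_field P ij) z <= 0) ->
  (forall (ij : chart_index M) z E, chart_cod ij z ->
     orthonormal_frame g ij z E -> divergence g nablaB P ij z E <= 0) ->
  is_warped_product f h.
Proof.
move=> M g mB rB mF rF sf fpos sh hpos _ _ lc _ ein _ _ n1ge2 n2ge2 _ _ _ piP _.
have [dh0|] := pselect (forall i x X,
    chart_cod i x -> 'D_X (in_chart h i) x = 0).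
  by right; exact: manifold_derive0_cst dh0.
move=> /existsNP[i /existsNP[x /existsNP[X /not_implyP[ix hX]]]].
left; apply: (manifold_derive0_cst mF sf) => j y V jy.
pose ij : chart_index M := (i, j).
have Uz : chart_cod ij (row_mx x y) by exact: chart_cod_row_mx.
have P0 w : chart_cod ij w -> lift_field P ij w = 0.
  move=> Uw; have := piP _ _ Uw; move: Uw; rewrite prod_chart_cod => -[w1 w2].
  rewrite /inner pairing_diag pairing0l mulr0 addr0 pmulr_rle0; last first.
    by rewrite exprn_gt0// /in_chart /=.
  rewrite leNgt => /negP Pneg.
  have [Pw|/(metric_pos rB w1)//] := eqVneq (P ij.1 (lsubmx w)) 0.
  by rewrite /lift_field /lift_vector Pw row_mx0.
have ric0 : ricci (nabla ij) (cst (lift_vector X)) (cst (fiber_vector n1 V))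
    (row_mx x y) = 0.
  rewrite -(@ricci_eq_on _ _ _ _ (semi_symmetric_connection g nabla P ij) _ _ _
    (@prod_chart_cod_open _ _ _ B F ij mB mF)
    (levi_civita_connection (lc ij)))//; last first.
    move=> A C w Uw; rewrite /semi_symmetric_connection /semi_symmetric.
    by rewrite /inner P0// scaler0 subr0 pairing0r scale0r addr0.
  rewrite (ein ij)//; [|exact: smooth_cst|exact: smooth_cst].
  by rewrite /inner pairing_diag pairing0l pairing0r !mulr0 addr0 mulr0.
have hx : 0 < in_chart h i x by exact: hpos.
have fy : 0 < in_chart f j y by exact: fpos.
have := ricci_doubly_warped_mixed X V mB rB mF rF sf fpos sh hpos lc ix jy.
rewrite ric0 => /esym/eqP; rewrite /dlog !mulf_eq0 !invr_eq0.
rewrite (gt_eqF hx) (gt_eqF fy) !orbF.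
have -> : ((n1 + n2)%:R - 2 == 0 :> R) = false.
  by apply/negbTE; rewrite subr_eq0 eqr_nat; lia.
by move=> /= /orP[/eqP/hX//|/eqP].
Qed.
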